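(* Let $M$ be an $m$-dimensional differential manifold, let $N$ be a connected $n$-dimensional differential manifold, and let $f:M\to N$ be a $C^1$-map such that $f(M)$ is closed in $N$ and $f(M)\neq N$. Then either all points of $M$ are critical points of $f$, or the set $C_f\subset M$ of all critical points of $f$ satisfies $\dim C_f\geq n-1$.
   Context: Differential manifolds are smooth manifolds without boundary in the usual sense (Hausdorff, second countable). A point $p\in M$ is a regular point of a $C^1$-map $f:M\to N$ if the differential $df_p:T_pM\to T_{f(p)}N$ is surjective; otherwise $p$ is a critical point of $f$. Dimension of subsets: let $\mathcal H^s$ denote the $s$-dimensional Hausdorff measure on $\mathbb R^m$. A subset $E$ of an $m$-dimensional differential manifold $M$ is said to be of $\mathcal H^s$-measure zero if $\mathcal H^s(\varphi(E\cap U))=0$ for every coordinate chart $(U,\varphi)$ of $M$. The dimension of $E$ is $\dim E=\inf\{s>0 : E \text{ is of } \mathcal H^s\text{-measure zero}\}$ (equivalently, its Hausdorff dimension under any smooth embedding of $M$ in a Euclidean space). *)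

(* Defs.v *)
From HB Require Import structures.
From mathcomp Require Import all_boot all_order all_algebra.
From mathcomp Require Import all_classical all_reals all_analysis.
Set Implicit Arguments.
Unset Strict Implicit.
Unset Printing Implicit Defensive.
Import Order.TTheory GRing.Theory Num.Theory.
Import numFieldNormedType.Exports.
Local Open Scope classical_set_scope.
Local Open Scope ring_scope.

(** * Maps of class C^k on an open subset of R^m *)

(* [g] is C^{k+1} when it is differentiable and [x |-> dg_x] is C^k; the latter
   is tested on each vector [v], which is equivalent in finite dimension. *)
Fixpoint Ck_on {R : realType} {m n : nat} (k : nat)
    (U : set 'rV[R]_m) (g : 'rV[R]_m -> 'rV[R]_n) : Prop :=
  match k with
  | 0%N => forall x, U x -> {for x, continuous g}
  | k'.+1 => (forall x, U x -> differentiable g x) /\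
             (forall v, Ck_on k' U (fun x => 'd g x v))
  end.

Definition smooth_on {R : realType} {m n : nat}
    (U : set 'rV[R]_m) (g : 'rV[R]_m -> 'rV[R]_n) : Prop :=
  forall k, Ck_on k U g.

(** * Smooth manifolds *)

(* The coordinate map and its inverse are total functions; their values outside
   the domain [chart_dom] and its image are irrelevant. *)
Record chart (R : realType) (T : topologicalType) (m : nat) := Chart {
  chart_dom : set T;
  chart_map :> T -> 'rV[R]_m;
  chart_inv : 'rV[R]_m -> T
}.

Definition is_chart {R : realType} {T : topologicalType} {m : nat}
    (c : chart R T m) : Prop :=
  [/\ open (chart_dom c),
      open (c @` chart_dom c),
      {in chart_dom c, cancel c (chart_inv c)},
      {within chart_dom c, continuous c} &
      {within c @` chart_dom c, continuous (chart_inv c)}].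

Definition transition {R : realType} {T : topologicalType} {m : nat}
    (c d : chart R T m) : 'rV[R]_m -> 'rV[R]_m :=
  d \o chart_inv c.

Definition compatible {R : realType} {T : topologicalType} {m : nat}
    (c d : chart R T m) : Prop :=
  smooth_on (c @` (chart_dom c `&` chart_dom d)) (transition c d) /\
  smooth_on (d @` (chart_dom c `&` chart_dom d)) (transition d c).

(* The smooth structure is a maximal atlas, so that the members of [atlas] are
   all the coordinate charts of the manifold. *)
Record manifold (R : realType) (m : nat) := Manifold {
  carrier :> topologicalType;
  atlas : set (chart R carrier m);
  manifold_hausdorff : hausdorff_space carrier;
  manifold_second_countable : @second_countable carrier;
  atlas_chart : forall c, atlas c -> is_chart c;
  atlas_cover : forall p : carrier, exists c, atlas c /\ chart_dom c p;
  atlas_compatible : forall c d, atlas c -> atlas d -> compatible c d;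
  atlas_maximal : forall c, is_chart c ->
    (forall d, atlas d -> compatible c d) -> atlas c
}.
Arguments atlas {R m} M : rename.

Definition chart_around {R : realType} {m : nat} (M : manifold R m) (p : M)
    (c : chart R M m) : Prop :=
  atlas M c /\ chart_dom c p.

Definition chart_at {R : realType} {m : nat} (M : manifold R m) (p : M) :
    chart R M m :=
  sval (cid (atlas_cover p)).

(** * C^1 maps, differentials, critical points *)

Definition local_expr {R : realType} {m n : nat} {M : manifold R m}
    {N : manifold R n} (f : M -> N) (c : chart R M m) (d : chart R N n) :
    'rV[R]_m -> 'rV[R]_n :=
  d \o f \o chart_inv c.

Definition C1_map {R : realType} {m n : nat} {M : manifold R m}
    {N : manifold R n} (f : M -> N) : Prop :=
  continuous f /\
  forall c d, atlas M c -> atlas N d ->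
    Ck_on 1 (c @` (chart_dom c `&` f @^-1` chart_dom d)) (local_expr f c d).

(* A tangent vector at [p] is its family of coordinates in all the charts
   around [p], related by the differentials of the transition maps. The value 0
   at the other charts makes this representation unique. *)
Definition tangent {R : realType} {m : nat} (M : manifold R m) (p : M) :
    set (chart R M m -> 'rV[R]_m) :=
  [set v | (forall c, ~ chart_around p c -> v c = 0) /\
           (forall c d, chart_around p c -> chart_around p d ->
              v d = 'd (transition c d) (c p) (v c))].

(* By the chain rule, any chart around [p] could be used instead of
   [chart_at p] when [f] is C^1 and [v] is a tangent vector at [p]. *)
Definition differential {R : realType} {m n : nat} {M : manifold R m}
    {N : manifold R n} (f : M -> N) (p : M) (v : chart R M m -> 'rV[R]_m) :
    chart R N n -> 'rV[R]_n :=
  fun d => if `[< chart_around (f p) d >]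
           then 'd (local_expr f (chart_at p) d) (chart_at p p) (v (chart_at p))
           else 0.

Definition regular_point {R : realType} {m n : nat} {M : manifold R m}
    {N : manifold R n} (f : M -> N) (p : M) : Prop :=
  set_surj (tangent p) (tangent (f p)) (differential f p).

Definition critical_set {R : realType} {m n : nat} {M : manifold R m}
    {N : manifold R n} (f : M -> N) : set M :=
  [set p | ~ regular_point f p].

(** * Hausdorff measure and dimension *)

(* The library norm on ['rV[R]_m] is the sup norm, whence this definition. *)
Definition euclidean_dist {R : realType} {m : nat} (x y : 'rV[R]_m) : R :=
  Num.sqrt (\sum_(i < m) (x 0 i - y 0 i) ^+ 2).

(* Since 0 is adjoined, the diameter of the empty set is 0 instead of -oo. *)
Definition diam {R : realType} {m : nat} (A : set 'rV[R]_m) : \bar R :=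
  ereal_sup (0%E |` [set (euclidean_dist z.1 z.2)%:E | z in A `*` A]).

Definition hausdorff_premeasure {R : realType} {m : nat} (s delta : R)
    (E : set 'rV[R]_m) : \bar R :=
  ereal_inf [set (\sum_(0 <= i <oo) poweR (diam (U i)) s)%E
            | U in [set U : nat -> set 'rV[R]_m |
                     E `<=` \bigcup_i U i /\
                     forall i, (diam (U i) <= delta%:E)%E]].

(* Used only for [0 < s]: at [s = 0] empty covering sets would count. The
   normalizing constant is taken to be 1. *)
Definition hausdorff_measure {R : realType} {m : nat} (s : R)
    (E : set 'rV[R]_m) : \bar R :=
  ereal_sup [set hausdorff_premeasure s delta E | delta in [set t : R | 0 < t]].

Definition hausdorff_null {R : realType} {m : nat} (M : manifold R m) (s : R)
    (E : set M) : Prop :=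
  forall c, atlas M c -> hausdorff_measure s (c @` (E `&` chart_dom c)) = 0%E.

Definition dimension {R : realType} {m : nat} (M : manifold R m)
    (E : set M) : \bar R :=
  ereal_inf [set s%:E | s in [set s : R | 0 < s /\ hausdorff_null s E]].

(* Main.v *)
Require Import Defs.
From HB Require Import structures.
From mathcomp Require Import all_boot all_order all_algebra.
From mathcomp Require Import finmap ring.
From mathcomp Require Import all_classical all_reals all_analysis.
Import Order.TTheory GRing.Theory Num.Theory.
Import numFieldNormedType.Exports.
Set Implicit Arguments.
Unset Strict Implicit.
Unset Printing Implicit Defensive.
Local Open Scope classical_set_scope.
Local Open Scope ring_scope.

(** Suppose that some point is regular and that the critical set [C] has
    dimension less than [n - 1], so that [C] is [H^s]-null for some
    [0 < s < n - 1].  The interior of the closed set [F = f(M)] is then a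
    nonempty, proper open subset of the connected manifold [N], and the
    contradiction comes from showing that this interior is also closed.

    A point of [F] outside the interior of [F] can only be the value of critical
    points, because a [C^1] map is open at its regular points
    ([regular_value_interior]).  Hence the frontier of [F] lies in [f(C)], and
    [f(C)] is [H^s]-null in every chart of [N], because [C^1] maps are locally
    Lipschitz and countably many charts cover [M] ([hnull_C1_image]).

    Now let [q] be a limit of interior points of [F] which is not itself
    interior.  A small ball around [q] in a chart is covered by the interior of
    [F], the complement of [F] and the null set [f(C)], and it meets the first
    two.  This is impossible, since an [H^s]-null set with [0 < s <= n - 1] does not
    separate a ball of [R^n] ([hnull_nonseparating]): fix a segment
    from one open set to the other; all segments parallel and close to it must
    cross the null set, so the projection of this set along their direction
    contains a ball of [R^(n-1)], whereas no ball of [R^k] is [H^s]-null for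
    [0 < s <= k] ([hnull_ball]). *)

(** * Hausdorff null sets of R^m *)

Lemma rV_normP {R : realType} {m : nat} (x : 'rV[R]_m) (e : R) : 0 <= e ->
  reflect (forall i, `|x 0 i| <= e) (`|x| <= e).
Proof.
move=> e0; apply: (iffP idP) => [xe i|xe].
  apply: le_trans xe; rewrite [leRHS]/Num.norm/= mx_normrE.
  exact: (@le_bigmax _ _ _ 0 (fun ij : 'I_1 * 'I_m => `|x ij.1 ij.2|) (0, i)).
rewrite [leLHS]/Num.norm/= mx_normrE; apply/bigmax_leP; split=> // -[i j] _ /=.
by rewrite ord1.
Qed.

Lemma norm_le_euclidean_dist {R : realType} {m : nat} (x y : 'rV[R]_m) :
  `|x - y| <= euclidean_dist x y.
Proof.
apply/rV_normP => [|i]; first exact: sqrtr_ge0.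
rewrite -sqrtr_sqr ler_sqrt; last by apply: sumr_ge0 => j _; exact: sqr_ge0.
rewrite !mxE (bigD1 i)//= lerDl; apply: sumr_ge0 => j _; exact: sqr_ge0.
Qed.

(** Vanishing of the [s]-dimensional Hausdorff measure, tested on countable
    coverings by balls of the sup norm.  No bound on
    the radii is imposed: for [0 < s] a small sum forces small radii.  A radius
    may be 0, and then the ball is empty. *)
Definition hnull {R : realType} {m : nat} (s : R) (E : set 'rV[R]_m) : Prop :=
  forall e : R, 0 < e -> exists (x : nat -> 'rV[R]_m) (r : nat -> R),
    [/\ forall i, 0 <= r i,
        E `<=` \bigcup_i ball (x i) (r i) &
        (\sum_(0 <= i <oo) (r i `^ s)%:E <= e%:E)%E].

Lemma hnullS {R : realType} {m : nat} (s : R) (A B : set 'rV[R]_m) :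
  A `<=` B -> hnull s B -> hnull s A.
Proof.
move=> AB nB e /nB[x [r [r0 cover sum]]]; exists x, r; split=> //.
exact: subset_trans AB cover.
Qed.

Lemma hnull0 {R : realType} {m : nat} (s : R) :
  0 < s -> hnull s (set0 : set 'rV[R]_m).
Proof.
move=> s0 e e0; exists (fun=> 0), (fun=> 0); split=> //.
rewrite eseries0 ?lee_fin ?ltW// => i _ _.
by rewrite powR0// gt_eqF.
Qed.

(** A set of diameter [d] lies in any ball centred at one of its points with
    radius greater than [d].  The radius chosen is twice the maximum of [d] and a
    positive number, needed when [d = 0]; the [s]-th powers of these numbers
    have a small sum. *)
Lemma hausdorff_measure_eq0_hnull {R : realType} {m : nat} (s : R)
    (E : set 'rV[R]_m) :
  0 < s -> hausdorff_measure s E = 0%E -> hnull s E.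
Proof.
move=> s0 HE e e0.
have s2 : 0 < 2 `^ s :> R by exact: powR_gt0.
(* The factor [2 ^ s] pays for the doubled radii [r i] below; half of the rest is
   spent on the diameters, half on the enlargement. *)
pose e' := e / 2 / 2 `^ s.
have e'0 : 0 < e' by rewrite !divr_gt0.
have : (hausdorff_premeasure s 1 E < e'%:E)%E.
  apply: (@le_lt_trans _ _ 0%E); last by rewrite lte_fin.
  by rewrite -HE; apply: ereal_sup_ubound; exists 1 => //=; exact: ltr01.
move=> /ereal_inf_lt[_ [U [EU dU] <-] sumU].
have d_ge0 i : (0 <= diam (U i))%E by apply: ereal_sup_ubound; left.
have d_fin i : diam (U i) \is a fin_num.
  by rewrite ge0_fin_numE//; apply: le_lt_trans (dU i) (ltry _).
pose d i := fine (diam (U i)).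
have d0 i : 0 <= d i by exact: fine_ge0.
pose h i := (e' / (2 ^ i.+1)%:R).
have h0 i : 0 < h i by rewrite divr_gt0// ltr0n expn_gt0.
pose r i := 2 * Num.max (d i) (h i `^ s^-1).
have hs0 i : 0 < h i `^ s^-1 by exact: powR_gt0.
have r0 i : 0 <= r i by rewrite mulr_ge0// le_max d0.
have /choice[x Ux] i : exists x, forall z, U i z -> U i x.
  have [->|/set0P[x ?]] := eqVneq (U i) set0; first by exists 0.
  by exists x.
exists x, r; split=> // [z /EU[i _ Uiz]|].
  exists i => //; rewrite -ball_normE /=.
  apply: (@le_lt_trans _ _ (d i)); last first.
    apply: (@le_lt_trans _ _ (Num.max (d i) (h i `^ s^-1))).
      by rewrite le_max lexx.
    by rewrite ltr_pMl ?ltr1n// lt_max hs0 orbT.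
  apply: le_trans (norm_le_euclidean_dist _ _) _.
  rewrite -lee_fin fineK//; apply: ereal_sup_ubound; right.
  by exists (x i, z) => //; split=> //=; exact: Ux Uiz.
have rs i : ((r i `^ s)%:E <= (2 `^ s)%:E * (poweR (diam (U i)) s + (h i)%:E))%E.
  rewrite -[diam _]fineK// -/(d i) poweR_EFin -EFinD -EFinM lee_fin.
  rewrite /r powRM ?ler_pM2l//; last by rewrite le_max d0.
  case: (leP (d i)) => _; last by rewrite lerDl ltW.
  by rewrite -powRrM mulVf ?gt_eqF// powRr1 ?lerDr ?powR_ge0// ltW.
apply: (@le_trans _ _ (\sum_(0 <= i <oo)
    ((2 `^ s)%:E * (poweR (diam (U i)) s + (h i)%:E)))%E).
  by apply: lee_nneseries => // i _; rewrite lee_fin powR_ge0.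
rewrite nneseriesZl; last first.
  by move=> i _; rewrite adde_ge0// ?poweR_ge0// lee_fin ltW.
have -> : e = 2 `^ s * (e' + e').
  by rewrite /e' -mulrDl -splitr mulrC divfK// gt_eqF.
rewrite EFinM EFinD lee_pmul2l//.
apply: le_trans (epsilon_trick _ _ (ltW e'0)) _.
  by move=> i; exact: poweR_ge0.
by rewrite leeD2r// ltW.
Qed.

Lemma hnull_bigcup_nat {R : realType} {m : nat} (s : R)
    (F : nat -> set 'rV[R]_m) :
  (forall j, hnull s (F j)) -> hnull s (\bigcup_j F j).
Proof.
move=> nF e e0.
have h0 j : 0 < e / (2 ^ j.+1)%:R by rewrite divr_gt0// ltr0n expn_gt0.
have /choice[x /choice[r xr]] j := nF j _ (h0 j).
have /card_esym/ppcard_eqP[f] := card_nat2.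
exists (fun k => x (f k).1 (f k).2), (fun k => r (f k).1 (f k).2).
have r0 j i : 0 <= r j i by have [] := xr j.
split=> [i|z [j _ Fjz]|]; first exact: r0.
  have [_ /(_ z Fjz)[i _ zi] _] := xr j.
  by exists (f^-1%FUN (j, i)) => //=; rewrite invK ?inE.
pose a (k : nat * nat) := (r k.1 k.2 `^ s)%:E.
have a0 k : (0 <= a k)%E by rewrite lee_fin powR_ge0.
rewrite (_ : (\sum_(0 <= i <oo) _ = \esum_(k in [set: nat * nat]) a k)%E); last first.
  have fT : f @` [set i | xpredT i] = setT by rewrite set_true image_eq.
  transitivity (\esum_(k in f @` [set i | xpredT i]) a k)%E; last by rewrite fT.
  rewrite esum_pred_image// => i j _ _.
  by apply: (@inj _ _ setT f); rewrite inE.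
rewrite (_ : setT = setT `*`` (fun=> setT)); last by apply/seteqP; split.
rewrite -(@esum_esum _ _ _ _ _ (fun j i => a (j, i)))//.
rewrite -(nneseries_esumT (a := fun j => \esum_(i in setT) a (j, i)))//; last first.
  by move=> j; apply: esum_ge0.
apply: le_trans (epsilon_trick0 xpredT (ltW e0)).
apply: lee_nneseries => [j _ _|j _]; first by apply: esum_ge0.
by rewrite -nneseries_esumT//; have [] := xr j.
Qed.

Lemma hnull_bigcup {R : realType} {m : nat} {I : Type} (s : R) (D : set I)
    (F : I -> set 'rV[R]_m) : 0 < s -> countable D ->
  (forall j, D j -> hnull s (F j)) -> hnull s (\bigcup_(j in D) F j).
Proof.
move=> s0 /countable_injP[f finj] nF.
apply: (@hnullS _ _ _ _ (\bigcup_n \bigcup_(j in D `&` [set j | f j = n]) F j)).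
  by move=> z [j Dj Fjz]; exists (f j) => //; exists j.
apply: hnull_bigcup_nat => n.
have [[j [Dj fjn]]|nj] := pselect (exists j, D j /\ f j = n).
  apply: (hnullS _ (nF _ Dj)) => z [i [Di fin] Fiz].
  by rewrite (finj j i) ?inE// fin.
by apply: hnullS (hnull0 s0) => z [j [Dj fj] _]; apply: nj; exists j.
Qed.

(** The centres of the covering balls need not belong to [E], where [g] is
    controlled; each ball which meets [E] is first replaced by a ball of twice
    the radius centred at a point of [E]. *)
Lemma hnull_lipschitz {R : realType} {m n : nat} (s k : R)
    (g : 'rV[R]_m -> 'rV[R]_n) (E : set 'rV[R]_m) :
  0 < s -> (forall x y, E x -> E y -> `|g x - g y| <= k * `|x - y|) ->
  hnull s E -> hnull s (g @` E).
Proof.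
move=> s0 gk nE e e0.
pose K := 2 * (`|k| + 1).
have K0 : 0 < K by rewrite mulr_gt0// ltr_wpDl.
have Ks0 : 0 < K `^ s by exact: powR_gt0.
have [x [r [r0 cover sum]]] := nE _ (divr_gt0 e0 Ks0).
have /choice[y Ey] i : exists y, forall z, E z -> ball (x i) (r i) z ->
    E y /\ ball (x i) (r i) y.
  have [[y [Ey xy]]|nj] := pselect (exists y, E y /\ ball (x i) (r i) y).
    by exists y.
  by exists 0 => z Ez xz; exfalso; apply: nj; exists z.
exists (g \o y), (fun i => K * r i); split=> [i|_ [z Ez <-]|].
- by rewrite mulr_ge0// ltW.
- have [i _ xz] := cover z Ez; exists i => //.
  have [Eyi xy] := Ey i z Ez xz; rewrite -ball_normE /=.
  have yz : `|y i - z| < 2 * r i.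
    rewrite mulr_natl mulr2n; apply: le_lt_trans (ler_distD (x i) _ _) _.
    by move: xy xz; rewrite -ball_normE /= => xy xz; rewrite ltrD// distrC.
  apply: le_lt_trans (gk _ _ Eyi Ez) _.
  apply: (@le_lt_trans _ _ ((`|k| + 1) * `|y i - z|)).
    by rewrite ler_wpM2r// (le_trans (ler_norm k))// lerDl.
  have -> : K * r i = (`|k| + 1) * (2 * r i) by rewrite [RHS]mulrCA mulrA.
  by rewrite ltr_pM2l// ltr_wpDl.
- apply: (@le_trans _ _ (\sum_(0 <= i <oo) ((K `^ s)%:E * (r i `^ s)%:E))%E).
    apply: lee_nneseries => [i _ _|i _]; first by rewrite lee_fin powR_ge0.
    by rewrite powRM// ltW.
  rewrite nneseriesZl; last by move=> i _; rewrite lee_fin powR_ge0.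
  have -> : e = K `^ s * (e / K `^ s) by rewrite mulrC divfK// gt_eqF.
  by rewrite EFinM lee_pmul2l.
Qed.

(** * Open sets of R^k are not null in dimension at most k *)

(** The interval has length [2 * r], so all of its grid points lie within
    [2 * r * L] steps of the smallest one. *)
Lemma card_grid_ball1 {R : realType} (L : nat) (c r : R) : 0 <= r ->
  #|[pred t : 'I_L | `|c - t%:R / L%:R| < r]|%:R <= 2 * r * L%:R + 1.
Proof.
move=> r0; set S := [pred t | _].
have rL0 : 0 <= 2 * r * L%:R by rewrite !mulr_ge0.
have [t St|S0] := pickP S; last by rewrite eq_card0// addr_ge0.
have L0 : (0 < L)%N by apply: leq_trans (ltn_ord t).
have LR0 : 0 < L%:R :> R by rewrite ltr0n.
case: (arg_minnP (fun t : 'I_L => t : nat) St) => t0 St0 t0min.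
apply: (@le_trans _ _ (Num.truncn (2 * r * L%:R)).+1%:R); last first.
  by rewrite -natr1 lerD2r truncn_le.
rewrite ler_nat cardE -(size_map (fun t : 'I_L => t - t0)%N).
rewrite -[leqRHS](size_iota 0).
apply: uniq_leq_size => [|x /mapP[u]].
  rewrite map_inj_in_uniq ?enum_uniq// => u v.
  rewrite !mem_enum => /t0min tu /t0min tv uv; apply: val_inj => /=.
  by rewrite -(subnK tu) uv subnK.
rewrite mem_enum => Su ->; rewrite mem_iota /= add0n ltnS.
have tu := t0min _ Su.
rewrite truncn_ge_nat// natrB// -ler_pdivrMr// mulrBl.
have -> : u%:R / L%:R - t0%:R / L%:R
    = (c - t0%:R / L%:R) - (c - u%:R / L%:R) :> R.
  by rewrite opprB [RHS]addrC addrA subrK.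
apply: le_trans (ler_norm _) _; apply: le_trans (ler_normB _ _) _.
by rewrite [leRHS]mulr_natl mulr2n lerD// ltW.
Qed.

Lemma card_grid_ball {R : realType} (k L : nat) (c : 'rV[R]_k) (r : R) :
  0 <= r ->
  #|[pred g : {ffun 'I_k -> 'I_L} | `[< ball c r (\row_i ((g i)%:R / L%:R)) >]]|%:R
    <= (2 * r * L%:R + 1) ^+ k.
Proof.
move=> r0.
pose F (i : 'I_k) : pred 'I_L := [pred t : 'I_L | `|c 0 i - t%:R / L%:R| < r].
apply: (@le_trans _ _ #|family F|%:R).
  rewrite ler_nat; apply: subset_leq_card; apply/fintype.subsetP => g gB.
  have [_ cg] : ball c r (\row_i ((g i)%:R / L%:R)) by apply/asboolP.
  apply/familyP => i; rewrite inE.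
  by have := cg 0 i; rewrite /ball /= mxE.
rewrite card_family foldrE big_map big_enum natr_prod /=.
rewrite -[X in _ <= _ ^+ X]card_ord -prodr_const.
by apply: ler_prod => i _; rewrite ler0n card_grid_ball1.
Qed.

(** By compactness, finitely many balls of the covering suffice.  A ball of radius
    [r] contains at most [(3 * r * L) ^ k] of the [L ^ k] points of a grid of
    step [1 / L], provided that [1 <= r * L].  So the sum of the [r ^ k],
    which is at most that of the [r ^ s] as all radii are at most 1, is at
    least [1 / 3 ^ k]. *)
Lemma hnull_cube {R : realType} (k : nat) (s : R) : 0 < s <= k%:R ->
  ~ hnull s [set v : 'rV[R]_k | forall i, v ord0 i \in `[0, 1]].
Proof.
move=> /andP[s0 sk] nQ.
have k0 : (0 < k)%N by rewrite -(ltr0n R); exact: lt_le_trans s0 sk.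
(* Any bound less than [3 ^- k] contradicts the counting estimate. *)
pose e : R := 3 ^- k / 2.
have e0 : 0 < e by rewrite divr_gt0// invr_gt0 exprn_gt0.
have e1 : e <= 1.
  apply: le_trans (_ : 3 ^- k <= 1).
    by rewrite ler_pdivrMr// ler_peMr ?ler1n// invr_ge0 exprn_ge0.
  by rewrite invf_le1 ?exprn_gt0// exprn_ege1// ler1n.
have [x [r [r0 cover sum]]] := nQ e e0.
have := @rV_compact R k (fun=> `[0, 1]%classic) (fun=> @segment_compact R 0 1).
rewrite compact_cover => /(_ _ setT (fun i => ball (x i) (r i)))[|//|D _ QD].
  by move=> i _; exact: ball_open.
have sumD : \sum_(i <- D) r i `^ s <= e.
  rewrite -lee_fin -sumEFin; apply: le_trans sum.
  by apply: (@lee_sum_fset_lim _ _ D xpredT) => i _; rewrite lee_fin powR_ge0.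
have rk i : i \in D -> r i ^+ k <= r i `^ s.
  move=> iD; have [->|rn0] := eqVneq (r i) 0.
    by rewrite expr0n gtn_eqF// powR_ge0.
  have ri0 : 0 < r i by rewrite lt_neqAle eq_sym rn0 r0.
  have ri1 : r i <= 1.
    rewrite leNgt; apply/negP => r1.
    have : r i `^ s <= e.
      apply: le_trans sumD; rewrite (big_rem _ iD)/= lerDl.
      by apply: sumr_ge0 => j _; exact: powR_ge0.
    apply/negP; rewrite -ltNge; apply: (le_lt_trans e1).
    by have := gt0_ltr_powR s0 (x := 1) (y := r i); rewrite powR1 !nnegrE => ->.
  by rewrite -powR_mulrn// ger_powR// ri0.
(* A step finer than all the positive radii in use. *)
pose L := (\max_(i <- D) (Num.truncn (r i)^-1).+1).+1.
have LR0 : 0 < L%:R :> R by rewrite ltr0n.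
have rL i : i \in D -> 0 < r i -> 1 <= r i * L%:R.
  move=> iD ri0; rewrite -ler_pdivrMl// mulr1.
  apply: (le_trans (ltW (truncnS_gt _))); rewrite ler_nat leqW//.
  exact: (@leq_bigmax_seq _ _ xpredT (fun i => (Num.truncn (r i)^-1).+1)).
pose p (g : {ffun 'I_k -> 'I_L}) : 'rV[R]_k := \row_i ((g i)%:R / L%:R).
pose G i : pred {ffun 'I_k -> 'I_L} :=
  [pred g | `[< ball (x i) (r i) (p g) >]].
have cardG i : i \in D -> #|G i|%:R <= (3 * L%:R) ^+ k * r i `^ s.
  move=> iD; apply: (@le_trans _ _ ((3 * L%:R) ^+ k * r i ^+ k)); last first.
    by rewrite ler_wpM2l ?rk// exprn_ge0// mulr_ge0.
  have [ri0|rn0] := eqVneq (r i) 0.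
    rewrite eq_card0 ?mulr_ge0 ?exprn_ge0 ?mulr_ge0// => g.
    by apply/asboolP; rewrite ri0 => -[]; rewrite ltxx.
  have ri0 : 0 < r i by rewrite lt_neqAle eq_sym rn0 r0.
  apply: le_trans (card_grid_ball L (x i) (r0 i)) _.
  rewrite -exprMn lerXn2r ?nnegrE ?addr_ge0 ?mulr_ge0//.
  have -> : 3 * L%:R * r i = 2 * r i * L%:R + r i * L%:R.
    by rewrite -mulrA (mulrC _ (r i)) -[3]natr1 mulrDl mul1r mulrA.
  by rewrite lerD2l rL.
have Gcover g : exists2 i, i \in D & G i g.
  have [|i /= iD pi] := QD (p g); last by exists i => //; apply/asboolP.
  move=> i /=; rewrite mxE in_itv /= divr_ge0//= ler_pdivrMr// mul1r ler_nat.
  exact: ltnW.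
have cardLk : L%:R ^+ k <= \sum_(i <- D) #|G i|%:R :> R.
  rewrite -natrX -natr_sum ler_nat.
  rewrite -[X in (_ ^ X)%N](card_ord k) -[X in (X ^ _)%N](card_ord L) -card_ffun.
  rewrite -sum1_card; under [leqRHS]eq_bigr do rewrite -sum1_card big_mkcond.
  rewrite exchange_big /=; apply: leq_sum => g _.
  have [i iD Gig] := Gcover g.
  by rewrite (big_rem _ iD)/= [_ \in _]Gig.
have : L%:R ^+ k <= (3 * L%:R) ^+ k * e :> R.
  apply: (le_trans cardLk); apply: (@le_trans _ _
      (\sum_(i <- D) (3 * L%:R) ^+ k * r i `^ s)).
    by rewrite big_seq [leRHS]big_seq; apply: ler_sum => i iD; exact: cardG.
  by rewrite -mulr_sumr ler_wpM2l// exprn_ge0// mulr_ge0.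
rewrite exprMn /e mulrACA mulfV ?expf_neq0// mul1r.
by rewrite ler_pMr ?exprn_gt0// leNgt invf_lt1// ltr1n.
Qed.

Lemma hnull_ball {R : realType} (k : nat) (s : R) (E : set 'rV[R]_k) a e :
  0 < s <= k%:R -> hnull s E -> 0 < e -> ~ (ball a e `<=` E).
Proof.
move=> sk nE e0 aE; apply: (hnull_cube sk).
have s0 : 0 < s by case/andP: sk.
pose c := 2 / e; have c0 : 0 < c by rewrite divr_gt0.
apply: hnullS (hnull_lipschitz (k := c) (g := fun x => c *: (x - a)) s0 _ nE).
  move=> v v01; exists (a + c^-1 *: v); last first.
    by rewrite addrAC subrr add0r scalerA mulfV ?scale1r// gt_eqF.
  apply: aE; rewrite -ball_normE /= opprD addrA subrr sub0r normrN normrZ.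
  have v1 : `|v| <= 1.
    apply/rV_normP => // i; have /(_ i) := v01; rewrite /= in_itv /= => /andP[v0 v1].
    by rewrite ger0_norm.
  rewrite invf_div ger0_norm ?divr_ge0 ?ltW//.
  apply: (@le_lt_trans _ _ (e / 2 * 1)); first by rewrite ler_wpM2l// divr_ge0// ltW.
  by rewrite mulr1 ltr_pdivrMr// ltr_pMr// ltr1n.
move=> x y _ _; rewrite -scalerBr opprB addrA subrK normrZ.
by rewrite ger0_norm// ltW.
Qed.

(** * Differential calculus on R^m *)

(** Joins the complete uniform structure of matrices to their norm, as required by
    Banach's fixed point theorem. *)
HB.instance Definition _ (R : realType) (m n : nat) :=
  Complete.on 'M[R]_(m, n).

Lemma ball_segment {R : realType} {V : normedModType R} (a x y : V) (r t : R) :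
  ball a r x -> ball a r y -> 0 <= t <= 1 -> ball a r (x + t *: (y - x)).
Proof.
rewrite -ball_normE /= => ax ay /andP[t0 t1].
have -> : a - (x + t *: (y - x)) = (1 - t) *: (a - x) + t *: (a - y).
  rewrite opprD addrA -scalerN opprB.
  rewrite scalerBl scale1r -[RHS]addrA [- _ + _]addrC -scalerBr.
  by rewrite [in RHS]opprB [a - y + _]addrC [in RHS]addrA subrK.
apply: le_lt_trans (ler_normD _ _) _; rewrite !normrZ.
rewrite (ger0_norm t0) ger0_norm ?subr_ge0//.
have [->|tn0] := eqVneq t 0; first by rewrite subr0 mul1r mul0r addr0.
have {}t0 : 0 < t by rewrite lt_neqAle eq_sym tn0.
have -> : r = (1 - t) * r + t * r by rewrite -mulrDl subrK mul1r.
by rewrite ler_ltD ?ltr_pM2l// ler_wpM2l ?subr_ge0// ltW.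
Qed.

Lemma diff_coord {R : realType} {m n : nat} (M v : 'M[R]_(m, n)) i j :
  'd (fun N : 'M[R]_(m, n) => N i j) M v = v i j.
Proof.
have @f : {linear 'M[R]_(m, n) -> R}.
  by exists (fun N : 'M[R]_(_, _) => N i j); do 2![eexists]; do ?[constructor];
     rewrite ?mxE// => ? *; rewrite ?mxE//; move=> ?; rewrite !mxE.
by rewrite (_ : (fun _ => _) = f)// diff_lin//; exact: coord_continuous.
Qed.

(** For the sup norm it is enough to apply the scalar mean value theorem to each
    coordinate along the segment from [y] to [x]. *)
Lemma mean_value_le {R : realType} {V : normedModType R} {n : nat}
    (g : V -> 'rV[R]_n) (a : V) (r k : R) : 0 <= k ->
  (forall z, ball a r z -> differentiable g z /\
     forall v, `|'d g z v| <= k * `|v|) ->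
  forall x y, ball a r x -> ball a r y -> `|g x - g y| <= k * `|x - y|.
Proof.
move=> k0 gk x y ax ay.
apply/rV_normP => [|i]; first by rewrite mulr_ge0.
pose c (t : R) : V := y + t *: (x - y).
pose phi (t : R) : R := g (c t) 0 i.
have cball (t : R) : t \in `[0, 1] -> ball a r (c t).
  by rewrite in_itv /= => t01; exact: ball_segment.
have dphi (t : R) : t \in `[0, 1] -> is_derive t 1 phi ('d g (c t) (x - y) 0 i).
  move=> /cball/gk[dg _].
  have dc : is_diff t c (fun h => h *: (x - y)).
    by apply: is_diff_eq; rewrite add0r.
  have dcoord : differentiable (fun v : 'rV[R]_n => v 0 i) (g (c t)).
    exact: differentiable_coord.
  have dgc : differentiable (g \o c) t by exact: differentiable_comp.
  have dp : differentiable phi t by exact: (differentiable_comp dgc dcoord).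
  apply: DeriveDef; first exact: diff_derivable.
  rewrite deriveE// (diff_comp dgc dcoord) /= diff_coord.
  have -> : 'd (g \o c) t = 'd g (c t) \o 'd c t :> (R -> _) by exact: diff_comp.
  by rewrite diff_val /= scale1r.
have phi_cont : {within `[0, 1], continuous phi}.
  apply: derivable_within_continuous => t t01.
  by have [] := dphi t t01.
have dphi_oo t := fun t01 : t \in `]0, 1[ => dphi t (subset_itv_oo_cc t01).
have [t t01] := MVT_segment ler01 dphi_oo phi_cont.
rewrite /phi /c scale1r scale0r addr0 subr0 mulr1 [y + _]addrC subrK => e1.
rewrite !mxE e1.
have [_ /(_ (x - y))] := gk _ (cball _ t01).
by move/rV_normP; apply; rewrite mulr_ge0.
Qed.

Lemma linear_rV_dist_le {R : realType} {m n : nat}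
    (A B : {linear 'rV[R]_m -> 'rV[R]_n}) (e : R) :
  (forall i, `|A 'e_i - B 'e_i| <= e) ->
  forall v, `|A v - B v| <= m%:R * e * `|v|.
Proof.
move=> ABe v.
have linE (C : {linear 'rV[R]_m -> 'rV[R]_n}) : C v = \sum_i v 0 i *: C 'e_i.
  rewrite [v in LHS]row_sum_delta linear_sum.
  by apply: eq_bigr => i _; rewrite linearZ.
rewrite !linE -sumrB; apply: le_trans (ler_norm_sum _ _ _) _.
apply: (@le_trans _ _ (\sum_(i < m) e * `|v|)).
  apply: ler_sum => i _; rewrite -scalerBr normrZ mulrC ler_pM//.
  by have /rV_normP := lexx `|v|; apply.
by rewrite sumr_const card_ord -mulrnAl mulr_natl.
Qed.

(** Continuity of the differential on each fixed vector implies continuity in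
    operator norm, because a linear map is controlled by its values on the
    canonical basis. *)
Lemma diff_continuous_near {R : realType} {m n : nat}
    (g : 'rV[R]_m -> 'rV[R]_n) (p : 'rV[R]_m) (e : R) : 0 < e ->
  (forall v, {for p, continuous (fun z => 'd g z v)}) ->
  \forall z \near p, forall v, `|'d g z v - 'd g p v| <= e * `|v|.
Proof.
move=> e0 cg.
pose e' := e / (m%:R + 1).
have m0 : 0 < m%:R + 1 :> R by rewrite ltr_wpDl.
have e'0 : 0 < e' by rewrite divr_gt0.
have g_near (i : 'I_m) : \forall z \near p, `|'d g p 'e_i - 'd g z 'e_i| < e'.
  by have /cvgrPdist_lt := cg 'e_i; apply.
have := filter_forall (nbhs_filter p) g_near.
apply: filterS => z gz v.
have gze' i : `|'d g z 'e_i - 'd g p 'e_i| <= e' by rewrite distrC ltW// gz.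
apply: le_trans (linear_rV_dist_le gze' v) _.
by rewrite ler_wpM2r// mulrC -mulrA ger_pMr// ler_pdivrMl// mulr1 lerDl.
Qed.

(** The mean value inequality applied to [g] minus its differential at [p], whose
    own differential is small near [p]. *)
Lemma Ck1_strict_diff {R : realType} {m n : nat} (U : set 'rV[R]_m)
    (g : 'rV[R]_m -> 'rV[R]_n) (p : 'rV[R]_m) (e : R) :
  open U -> Ck_on 1 U g -> U p -> 0 < e ->
  exists2 r : R, 0 < r & ball p r `<=` U /\
    forall x y, ball p r x -> ball p r y ->
      `|g x - g y - 'd g p (x - y)| <= e * `|x - y|.
Proof.
move=> oU [dg cg] Up e0.
have /nbhs_ballP[r /= r0 pr] : nbhs p (U `&`
    [set z | forall v, `|'d g z v - 'd g p v| <= e * `|v|]).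
  apply: filterI; first exact: open_nbhs_nbhs.
  by apply: diff_continuous_near => // v; exact: cg.
exists r => //; split=> [z /pr[]//|x y px py].
have cdg : continuous ('d g p) by apply: diff_continuous; exact: dg.
pose A : 'rV[R]_m -> 'rV[R]_n := 'd g p.
pose h : 'rV[R]_m -> 'rV[R]_n := g - A.
have hE z : h z = g z - A z by [].
have -> : g x - g y - 'd g p (x - y) = h x - h y.
  rewrite linearB !hE /A !opprB addrACA [RHS]addrACA.
  by rewrite [- g y + _]addrC.
have dh z : ball p r z -> differentiable h z /\
    forall v, `|'d h z v| <= e * `|v|.
  move=> /pr[Uz dgz].
  have dA : differentiable A z by exact: linear_differentiable.
  have dAE : 'd A z = A :> (_ -> _) by exact: diff_lin.
  split=> [|v]; first by exact: (@differentiableB _ _ _ g A z (dg z Uz) dA).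
  have dhv : 'd h z v = 'd g z v - 'd A z v.
    exact: (congr1 (@^~ v) (@diffB _ _ _ g A z (dg z Uz) dA)).
  move/funeqP : dAE => /(_ v) dAv.
  have subst_le (u v1 v2 v3 : 'rV[R]_n) (t : R) :
    u = v1 - v2 -> v2 = v3 -> `|v1 - v3| <= t -> `|u| <= t by move=> -> ->.
  exact: (subst_le _ _ _ _ _ dhv dAv (dgz v)).
exact: (@mean_value_le _ _ _ h p r e (ltW e0) dh).
Qed.

Lemma Ck1_locally_lipschitz {R : realType} {m n : nat} (U : set 'rV[R]_m)
    (g : 'rV[R]_m -> 'rV[R]_n) (p : 'rV[R]_m) :
  open U -> Ck_on 1 U g -> U p ->
  exists2 r : R, 0 < r & ball p r `<=` U /\
    exists k, forall x y, ball p r x -> ball p r y ->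
      `|g x - g y| <= k * `|x - y|.
Proof.
move=> oU C1g Up; have [dg _] := C1g.
have [r r0 [rU gr]] := Ck1_strict_diff oU C1g Up ltr01.
have [k k0 gk] := linear_lipschitz (diff_continuous (dg p Up)).
exists r => //; split=> //; exists (1 + k) => x y px py.
rewrite -(subrK ('d g p (x - y)) (g x - g y)) mulrDl.
by apply: le_trans (ler_normD _ _) _; rewrite lerD ?gr ?gk.
Qed.

Lemma linear_surj_right_inverse {R : realType} {m n : nat}
    (A : {linear 'rV[R]_m -> 'rV[R]_n}) : (forall w, exists v, A v = w) ->
  exists L : {linear 'rV[R]_n -> 'rV[R]_m}, (forall w, A (L w) = w) /\
    exists2 k, 0 < k & forall w, `|L w| <= k * `|w|.
Proof.
move=> surjA.
have /choice[b Ab] i := surjA ('e_i : 'rV[R]_n).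
have [L LE] : exists L : {linear 'rV[R]_n -> 'rV[R]_m},
    forall w, L w = \sum_i w 0 i *: b i.
  exists (mulmxr (\matrix_i b i)) => w.
  by rewrite /= mulmx_sum_row; apply: eq_bigr => i _; rewrite rowK.
exists L; split=> [w|].
  rewrite LE linear_sum [RHS]row_sum_delta; apply: eq_bigr => i _.
  by rewrite linearZ Ab.
exists (\sum_i `|b i| + 1) => [|w]; first by rewrite ltr_wpDl// sumr_ge0.
rewrite LE; apply: le_trans (ler_norm_sum _ _ _) _.
rewrite mulrDl mulr_suml ler_wpDr ?mul1r//; apply: ler_sum => i _.
rewrite normrZ mulrC ler_wpM2l//.
by have /rV_normP := lexx `|w|; apply.
Qed.

(** The surjectivity half of the inverse function theorem.  Let [L] be a linear
    right inverse of the differential.  To solve [g (p + L w) = z], iterate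
    [w |-> w - g (p + L w) + z]: strict differentiability makes this map
    1/2-Lipschitz on a small closed ball, which it preserves when [z] is close to
    [g p]. *)
Lemma Ck1_submersion_interior {R : realType} {m n : nat} (U : set 'rV[R]_m)
    (g : 'rV[R]_m -> 'rV[R]_n) (p : 'rV[R]_m) :
  open U -> Ck_on 1 U g -> U p -> (forall w, exists v, 'd g p v = w) ->
  nbhs (g p) (g @` U).
Proof.
move=> oU C1g Up /linear_surj_right_inverse[L [AL [c c0 Lc]]].
have e0 : 0 < (2 * c)^-1 by rewrite invr_gt0 mulr_gt0.
have [r r0 [rU gr]] := Ck1_strict_diff oU C1g Up e0.
(* [L] maps the ball of radius [rho] into that of radius [r / 2]. *)
pose rho := r / (2 * c).
have rho0 : 0 < rho by rewrite divr_gt0// mulr_gt0.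
apply/nbhs_ballP; exists (rho / 2); first by rewrite /= divr_gt0.
move=> z; rewrite -ball_normE /= => gz.
pose T w := w - g (p + L w) + z.
pose D := closed_ball_ Num.norm (0 : 'rV[R]_n) rho.
have pL w : D w -> ball p r (p + L w).
  rewrite /D /closed_ball_ /= sub0r normrN => wrho.
  rewrite -ball_normE /= opprD addrA subrr sub0r normrN.
  apply: le_lt_trans (Lc w) _; apply: (@le_lt_trans _ _ (c * rho)).
    by rewrite ler_pM2l.
  rewrite /rho mulrC -mulrA invfM mulfVK ?gt_eqF//.
  by rewrite ltr_pdivrMr// ltr_pMr// ltr1n.
have T_contr w w' : D w -> D w' -> `|T w - T w'| <= 2^-1 * `|w - w'|.
  move=> Dw Dw'.
  have := gr _ _ (pL _ Dw) (pL _ Dw').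
  have -> : p + L w - (p + L w') = L (w - w').
    by rewrite linearB opprD addrACA subrr add0r.
  rewrite AL distrC.
  have -> : w - w' - (g (p + L w) - g (p + L w')) = T w - T w'.
    rewrite /T [in RHS]opprD [RHS]addrACA subrr addr0 !opprB addrACA [RHS]addrACA.
    by rewrite [- w' + _]addrC.
  move=> /le_trans; apply.
  apply: le_trans (ler_wpM2l (ltW e0) (Lc _)) _.
  by rewrite invfM -mulrA mulKf// gt_eqF.
have T0 : `|T 0| <= rho / 2.
  by rewrite /T linear0 addr0 sub0r addrC distrC ltW.
have D0 : D 0 by rewrite /D /closed_ball_ /= subrr normr0 ltW.
have TD : {homo T : w / D w >-> D w}.
  move=> w Dw; rewrite /D /closed_ball_ /= sub0r normrN.
  rewrite -(subrK (T 0) (T w)) [rho]splitr.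
  apply: le_trans (ler_normD _ _) _; rewrite lerD//.
  apply: le_trans (T_contr _ _ Dw D0) _.
  rewrite subr0 mulrC ler_wpM2r// ?invr_ge0//.
  by move: Dw; rewrite /D /closed_ball_ /= sub0r normrN.
have contrT : is_contraction (mkfun TD).
  exists (2^-1)%:nng; split; first by rewrite /= invf_lt1// ltr1n.
  by move=> [w w'] [/= Dw Dw'] ; exact: T_contr.
have [w Dw Tw] := banach_fixed_point contrT
  (@closed_closed_ball_ _ _ _ _) (ex_intro _ 0 D0).
exists (p + L w); first by apply: rU; exact: pL.
apply/eqP; rewrite eq_sym -subr_eq0 addrC; apply/eqP.
by apply: (@addrI _ w); rewrite addr0 addrA -[RHS]/w [RHS]Tw.
Qed.

(** * Null sets do not separate *)

(** Otherwise the parameters in [A] and those in [B] would disconnect [0, 1]. *)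
Lemma segment_crosses {R : realType} {V : normedModType R} (A B Z : set V)
    (x y : V) :
  open A -> open B -> A `&` B = set0 -> A x -> B y ->
  (forall t, 0 <= t <= 1 -> (A `|` B `|` Z) (x + t *: (y - x))) ->
  exists t, Z (x + t *: (y - x)).
Proof.
move=> oA oB AB0 Ax By cover; apply: contrapT => noZ.
pose c (t : R) : V := x + t *: (y - x).
have cc : continuous c.
  move=> t; apply: cvgD; first exact: cvg_cst.
  by apply: cvgZr_tmp; exact: cvg_id.
have oAc : open (c @^-1` A) by apply: open_comp.
have oBc : open (c @^-1` B) by apply: open_comp.
have cAB t : `[0, 1]%classic t -> (c @^-1` A) t \/ (c @^-1` B) t.
  rewrite /= in_itv /= => /cover[[|]|Zt]; [by left|by right|].
  by case: noZ; exists t.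
have AE : `[0, 1]%classic `&` c @^-1` A = `[0, 1]%classic `&` ~` (c @^-1` B).
  apply/seteqP; split=> t [t01 ct]; split=> //.
    by move=> Bt; have : (A `&` B) (c t) by []; rewrite AB0.
  by case: (cAB t t01).
have : `[0, 1]%classic `&` c @^-1` A = `[0, 1]%classic.
  apply: segment_connected.
  - by exists 0; split; rewrite /= ?in_itv /= ?lexx ?ler01// /c scale0r addr0.
  - by exists (c @^-1` A).
  - by exists (~` (c @^-1` B)) => //; exact: open_closedC.
move=> /seteqP[_ /(_ 1)].
rewrite /= in_itv /= lexx ler01 => /(_ isT)[_].
rewrite /c scale1r addrC subrK => Ay.
by have : (A `&` B) y by []; rewrite AB0.
Qed.

(** Let [u] join a point [a] of [A] to a point of [B], and let [i] be a coordinate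
    with [u_i <> 0].  The linear map [P] projects along [u] onto the hyperplane
    of equation [x_i = 0], seen as [R^k]; it is Lipschitz, so it maps [Z] to a
    null set.  Every translate of the segment by a small [h] of this hyperplane
    still runs from [A] to [B] inside the ball, hence crosses [Z], and [P] takes
    the value [P a + h] at the crossing point. *)
Lemma hnull_nonseparating {R : realType} {k : nat} (s : R)
    (A B Z : set 'rV[R]_k.+1) (q : 'rV[R]_k.+1) (r : R) :
  0 < s <= k%:R -> open A -> open B -> A `&` B = set0 ->
  A `&` ball q r !=set0 -> B `&` ball q r !=set0 ->
  ball q r `<=` A `|` B `|` Z -> ~ hnull s Z.
Proof.
move=> sk oA oB AB0 [a [Aa qa]] [b [Bb qb]] cover nZ.
have s0 : 0 < s by case/andP: sk.
pose u := b - a.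
have [i ui] : exists i, u 0 i != 0.
  apply: contrapT => nu; have : (A `&` B) a.
    split=> //; suff -> : a = b by [].
    apply/esym/eqP; rewrite -subr_eq0; apply/eqP/rowP => i.
    rewrite [RHS]mxE; apply: contrapT => /eqP ui; apply: nu; exists i.
    exact: ui.
  by rewrite AB0.
(* Dropping the coordinate [i], which vanishes after the projection, lands in
   [R^k]. *)
pose P (x : 'rV[R]_k.+1) : 'rV[R]_k := col' i (x - (x 0 i / u 0 i) *: u).
have PE x j : P x 0 j = x 0 (lift i j) - x 0 i / u 0 i * u 0 (lift i j).
  by rewrite /P !mxE.
have P_lip x y : `|P x - P y| <= (1 + `|(u 0 i)^-1| * `|u|) * `|x - y|.
  apply/rV_normP => [|j]; first by rewrite mulr_ge0// addr_ge0// mulr_ge0.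
  rewrite mxE [(- P y) _ _]mxE !PE.
  have -> : x 0 (lift i j) - x 0 i / u 0 i * u 0 (lift i j) -
      (y 0 (lift i j) - y 0 i / u 0 i * u 0 (lift i j)) =
      (x - y) 0 (lift i j) - (x - y) 0 i * ((u 0 i)^-1 * u 0 (lift i j)).
    by rewrite !mxE; ring.
  apply: le_trans (ler_normB _ _) _; rewrite mulrDl mul1r !normrM.
  have coord (v : 'rV[R]_k.+1) l : `|v 0 l| <= `|v|.
    by have /rV_normP := lexx `|v|; apply.
  by rewrite lerD// mulrC ler_pM ?mulr_ge0// ler_wpM2l.
have /nbhs_ballP[d1 /= d10 ad1] : nbhs a (A `&` ball q r).
  by apply: filterI; apply: open_nbhs_nbhs; split=> //; exact: ball_open.
have /nbhs_ballP[d2 /= d20 bd2] : nbhs b (B `&` ball q r).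
  by apply: filterI; apply: open_nbhs_nbhs; split=> //; exact: ball_open.
have d0 : 0 < Num.min d1 d2 by rewrite lt_min d10.
apply: (hnull_ball sk (hnull_lipschitz s0 (fun x y _ _ => P_lip x y) nZ) d0
  (a := P a)).
move=> y; rewrite -ball_normE /= lt_min => /andP[y1 y2].
(* The vector of the hyperplane whose projection is [y - P a]. *)
pose h : 'rV[R]_k.+1 := \row_j if unlift i j is Some l then (y - P a) 0 l else 0.
have hi : h 0 i = 0 by rewrite mxE unlift_none.
have hl l : h 0 (lift i l) = y 0 l - P a 0 l by rewrite mxE liftK !mxE.
have hy : `|h| <= `|P a - y|.
  apply/rV_normP => // j; rewrite mxE; case: unliftP => [l _|_]; last first.
    by rewrite normr0.
  by rewrite distrC; have /rV_normP := lexx `|y - P a|; apply.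
have h_in x d : `|P a - y| < d -> ball x d (x + h).
  move=> yd; rewrite -ball_normE /= opprD addrA subrr sub0r normrN.
  exact: le_lt_trans yd.
have [Aah qah] := ad1 _ (h_in _ _ y1).
have [Bbh qbh] := bd2 _ (h_in _ _ y2).
have [t Zt] := @segment_crosses R _ A B Z _ _ oA oB AB0 Aah Bbh
  (fun t t01 => cover _ (ball_segment qah qbh t01)).
exists (a + h + t *: (b + h - (a + h))) => //.
apply/rowP => l; rewrite PE.
have -> : b + h - (a + h) = u by rewrite opprD addrACA subrr addr0.
have coordE j : (a + h + t *: u) 0 j = a 0 j + h 0 j + t * u 0 j.
  by rewrite mxE [(a + h) 0 j]mxE [(t *: u) 0 j]mxE.
by rewrite !coordE hi hl PE; field.
Qed.

(** * Charts, tangent vectors and regular points *)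

Lemma is_chart_invK {R : realType} {T : topologicalType} {m : nat}
    (c : chart R T m) (p : T) :
  is_chart c -> chart_dom c p -> chart_inv c (c p) = p.
Proof. by move=> [_ _ cK _ _] cp; apply: cK; rewrite inE. Qed.

Lemma is_chart_continuous {R : realType} {T : topologicalType} {m : nat}
    (c : chart R T m) (p : T) :
  is_chart c -> chart_dom c p -> {for p, continuous c}.
Proof.
move=> [oc _ _ cc _] cp; move: cc; rewrite continuous_open_subspace//.
by apply; rewrite inE.
Qed.

Lemma is_chart_inv_continuous {R : realType} {T : topologicalType} {m : nat}
    (c : chart R T m) (p : T) :
  is_chart c -> chart_dom c p -> {for c p, continuous (chart_inv c)}.
Proof.
move=> [_ oc _ _ cc] cp; move: cc; rewrite continuous_open_subspace//.
by apply; rewrite inE; exists p.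
Qed.

Lemma is_chart_image_open {R : realType} {T : topologicalType} {m : nat}
    (c : chart R T m) (V : set T) :
  is_chart c -> open V -> open (c @` (chart_dom c `&` V)).
Proof.
move=> hc oV; rewrite openE => _ [p [cp Vp] <-].
have [_ oc _ _ _] := hc.
have invV : nbhs (c p) (chart_inv c @^-1` V).
  apply: (is_chart_inv_continuous hc cp); rewrite is_chart_invK//.
  exact: open_nbhs_nbhs.
have imc : nbhs (c p) (c @` chart_dom c).
  by apply: open_nbhs_nbhs; split=> //; exists p.
apply: filterS (filterI invV imc) => z [/= + [y cy yz]].
by rewrite -yz is_chart_invK// => Vy; exists y.
Qed.

Lemma is_chart_nbhs_preimage {R : realType} {T : topologicalType} {m : nat}
    (c : chart R T m) (p : T) (W : set 'rV[R]_m) :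
  is_chart c -> chart_dom c p -> nbhs (c p) W ->
  nbhs p (chart_dom c `&` c @^-1` W).
Proof.
move=> hc cp cW; apply: filterI; last exact: is_chart_continuous.
by have [oc _ _ _ _] := hc; exact: open_nbhs_nbhs.
Qed.

Lemma chart_at_around {R : realType} {m : nat} (M : manifold R m) (p : M) :
  chart_around p (chart_at p).
Proof. by rewrite /chart_at; case: cid. Qed.

Lemma transition_differentiable {R : realType} {m : nat} (M : manifold R m)
    (p : M) (c d : chart R M m) :
  chart_around p c -> chart_around p d -> differentiable (transition c d) (c p).
Proof.
move=> [Mc cp] [Md dp]; have [/(_ 1%N)[+ _] _] := atlas_compatible Mc Md.
by apply; exists p.
Qed.

Lemma near_chart_image {R : realType} {T : topologicalType} {m : nat}
    (c : chart R T m) (p : T) (V : set T) :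
  is_chart c -> chart_dom c p -> open V -> V p ->
  nbhs (c p) (c @` (chart_dom c `&` V)).
Proof.
move=> hc cp oV Vp; apply: open_nbhs_nbhs; split; last by exists p.
exact: is_chart_image_open.
Qed.

Lemma diff_transition_id {R : realType} {m : nat} (M : manifold R m)
    (p : M) (c : chart R M m) (w : 'rV[R]_m) :
  chart_around p c -> 'd (transition c c) (c p) w = w.
Proof.
move=> pc; have [Mc cp] := pc; have hc := atlas_chart Mc.
rewrite -(deriveE w (transition_differentiable pc pc)) -[RHS](derive_id (c p)).
apply: near_eq_derive.
have := near_chart_image hc cp openT I; apply: filterS => z [y [cy _] <-].
by rewrite /transition /= is_chart_invK.
Qed.

(** Chain rule for a map which is only locally a composite, as transition maps
    are. *)
Lemma diff_near_comp {R : realType} {U V W : normedModType R}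
    (f : U -> V) (g : V -> W) (h : U -> W) (x v : U) (y : V) :
  f x = y -> differentiable f x -> differentiable g y -> differentiable h x ->
  (\forall z \near x, h z = g (f z)) -> 'd h x v = 'd g y ('d f x v).
Proof.
move=> <-{y} df dg dh hgf; have dgf := differentiable_comp df dg.
rewrite -(deriveE v dh) (near_eq_derive v hgf) (deriveE v dgf).
by move/funeqP : (diff_comp df dg) => /(_ v).
Qed.

Lemma diff_transition_comp {R : realType} {m : nat} (M : manifold R m)
    (p : M) (c d e : chart R M m) (w : 'rV[R]_m) :
  chart_around p c -> chart_around p d -> chart_around p e ->
  'd (transition c e) (c p) w
    = 'd (transition d e) (d p) ('d (transition c d) (c p) w).
Proof.
move=> pc pd pe; have [Mc cp] := pc; have [Md dp] := pd.
have hc := atlas_chart Mc; have hd := atlas_chart Md.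
have cdp : transition c d (c p) = d p by rewrite /transition /= is_chart_invK.
apply: (diff_near_comp w cdp); [exact: transition_differentiable..|].
have [od _ _ _ _] := hd.
have := near_chart_image hc cp od dp; apply: filterS => z [y [cy dy] <-].
by rewrite /transition /= !is_chart_invK.
Qed.

(** A vector in one chart extends to a family of coordinates in all charts through
    the differentials of the transition maps; the compatibility required of a
    tangent vector is the chain rule. *)
Lemma tangent_with_coordinates {R : realType} {m : nat} (M : manifold R m)
    (p : M) (c : chart R M m) (w : 'rV[R]_m) : chart_around p c ->
  exists2 v, tangent p v & v c = w.
Proof.
move=> pc.
exists (fun d => if `[< chart_around p d >] then 'd (transition c d) (c p) w else 0).
  split=> [d npd|d e pd pe]; first by rewrite asboolF.
  by rewrite !asboolT//; exact: diff_transition_comp.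
by rewrite asboolT// diff_transition_id.
Qed.

Lemma regular_point_diff_surj {R : realType} {m n : nat} (M : manifold R m)
    (N : manifold R n) (f : M -> N) (p : M) (d : chart R N n) :
  regular_point f p -> chart_around (f p) d ->
  forall w, exists v, 'd (local_expr f (chart_at p) d) (chart_at p p) v = w.
Proof.
move=> reg fpd w; have [v' Tv' v'w] := tangent_with_coordinates w fpd.
have [v _ fv] := reg v' Tv'.
exists (v (chart_at p)); rewrite -v'w -fv.
by rewrite /differential asboolT.
Qed.

(** In charts this is the openness of a [C^1] map at a point where its differential
    is surjective. *)
Lemma regular_value_interior {R : realType} {m n : nat} (M : manifold R m)
    (N : manifold R n) (f : M -> N) (p : M) :
  C1_map f -> regular_point f p -> nbhs (f p) (range f).
Proof.
move=> [cf f1] reg.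
set c := chart_at p; set d := chart_at (f p).
have [Mc cp] : chart_around p c := chart_at_around p.
have fpd : chart_around (f p) d := chart_at_around (f p).
have [Nd dfp] := fpd.
have hc := atlas_chart Mc; have hd := atlas_chart Nd.
have [od _ _ _ _] := hd.
have ofd : open (f @^-1` chart_dom d) by apply: open_comp.
have := Ck1_submersion_interior (is_chart_image_open hc ofd) (f1 _ _ Mc Nd)
  (ex_intro2 _ _ p (conj cp dfp) erefl) (regular_point_diff_surj reg fpd).
rewrite /local_expr /= is_chart_invK// => /(is_chart_nbhs_preimage hd dfp).
apply: filterS => y [dy [_ [q [cq dfq] <-]]] /=.
rewrite is_chart_invK// => fqy; exists q => //.
by rewrite -(is_chart_invK hd dfq) fqy is_chart_invK.
Qed.

(** Countably many sets of a basis, each with null trace, cover [E]; this avoids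
    choosing a countable atlas. *)
Lemma hnull_second_countable {R : realType} {T : topologicalType} {n : nat}
    (s : R) (E : set T) (g : T -> 'rV[R]_n) :
  0 < s -> @second_countable T ->
  (forall p, E p -> exists2 V, nbhs p V & hnull s (g @` (E `&` V))) ->
  hnull s (g @` E).
Proof.
move=> s0 [B cB [oB nB]] loc.
pose D := [set b | B b /\ hnull s (g @` (E `&` b))].
apply: (@hnullS _ _ _ _ (\bigcup_(b in D) (g @` (E `&` b)))).
  move=> _ [p Ep <-]; have [V pV nV] := loc p Ep.
  have [b [Bb bp] bV] := nB p V pV.
  exists b; last by exists p.
  split=> //; apply: hnullS nV => _ [q [Eq bq] <-]; exists q => //.
  by split=> //; exact: bV.
apply: hnull_bigcup => //; last by move=> b [].
by apply: sub_countable cB; apply: subset_card_le => b [].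
Qed.

(** Around each point, the local expression of [f] is Lipschitz, and null sets are
    preserved by Lipschitz maps. *)
Lemma hnull_C1_image {R : realType} {m n : nat} (M : manifold R m)
    (N : manifold R n) (f : M -> N) (s : R) (E : set M) (d : chart R N n) :
  0 < s -> C1_map f ->
  (forall c, atlas M c -> hnull s (c @` (E `&` chart_dom c))) ->
  atlas N d -> hnull s (d @` (f @` E `&` chart_dom d)).
Proof.
move=> s0 [cf f1] nE Nd.
have [od _ _ _ _] := atlas_chart Nd.
have ofd : open (f @^-1` chart_dom d) by apply: open_comp.
apply: (@hnullS _ _ _ _ ((d \o f) @` (E `&` f @^-1` chart_dom d))).
  by move=> _ [_ [[p Ep <-] dfp] <-]; exists p.
apply: hnull_second_countable => //; first exact: manifold_second_countable.
move=> p [Ep dfp]; have [Mc cp] := chart_at_around p.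
set c := chart_at p in Mc cp *; have hc := atlas_chart Mc.
have cU : (c @` (chart_dom c `&` f @^-1` chart_dom d)) (c p) by exists p.
have [r r0 [_ [k fk]]] :=
  Ck1_locally_lipschitz (is_chart_image_open hc ofd) (f1 _ _ Mc Nd) cU.
exists (chart_dom c `&` c @^-1` ball (c p) r).
  by apply: is_chart_nbhs_preimage => //; exact: nbhsx_ballx.
have nEr : hnull s (c @` (E `&` chart_dom c) `&` ball (c p) r).
  by apply: hnullS (nE _ Mc) => z [].
apply: hnullS (hnull_lipschitz (g := local_expr f c d) s0 _ nEr).
  move=> _ [q [[Eq _] [cq rq]] <-].
  exists (c q); first by split=> //; exists q.
  by rewrite /local_expr /= is_chart_invK.
by move=> x y [_ rx] [_ ry]; exact: fk.
Qed.

Theorem theorem1p2 (R : realType) (m n : nat)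
    (M : manifold R m) (N : manifold R n) (f : M -> N)
    (N_connected : connected [set: N])
    (f_C1 : C1_map f)
    (f_closed : closed (range f))
    (f_not_onto : range f <> [set: N]) :
  (forall p : M, critical_set f p) \/
  ((n%:R - 1)%:E <= dimension (critical_set f))%E.
Proof.
have [allcrit|] := pselect (forall p, critical_set f p); first by left.
move=> /existsNP[p0 /contrapT p0_regular]; right.
rewrite leNgt; apply/negP => /ereal_inf_lt[_ [s [s0 C_null] <-]].
rewrite lte_fin => sn.
(* For [n = 0] the assumption reads [s < - 1]. *)
case: n N f N_connected f_C1 f_closed f_not_onto p0_regular C_null sn
  => [|k] N f N_connected f_C1 f_closed f_not_onto p0_regular C_null sn.
  by move: sn; rewrite sub0r ltNge (le_trans (lerN10 _)) ?ltW.
have sk : 0 < s <= k%:R by rewrite s0 ltW//; rewrite -natr1 addrK in sn.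
have {}C_null c : atlas M c -> hnull s (c @` (critical_set f `&` chart_dom c)).
  by move=> Mc; apply: hausdorff_measure_eq0_hnull => //; exact: C_null.
apply: f_not_onto; suff intE : (range f)° = [set: N].
  by apply/seteqP; split=> // y _; apply: interior_subset; rewrite intE.
apply: N_connected.
- by exists (f p0); exact: regular_value_interior.
- by exists (range f)°; [exact: open_interior|rewrite setTI].
exists (range f)°; last by rewrite setTI.
(* The interior of the range is closed. *)
move=> q clq; apply: contrapT => nq.
have [Nd dq] := chart_at_around q; set d := chart_at q in Nd dq.
have hd := atlas_chart Nd; have [_ odim _ _ _] := hd.
have /nbhs_ballP[r /= r0 rd] : nbhs (d q) (d @` chart_dom d).
  by apply: open_nbhs_nbhs; split=> //; exists q.
have qr := is_chart_nbhs_preimage hd dq (nbhsx_ballx (d q) _ r0).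
apply: (hnull_nonseparating (A := d @` (chart_dom d `&` (range f)°))
  (B := d @` (chart_dom d `&` ~` range f)) (q := d q) (r := r) sk _ _ _ _ _ _
  (hnull_C1_image s0 f_C1 C_null Nd)).
- by apply: is_chart_image_open => //; exact: open_interior.
- by apply: is_chart_image_open => //; exact: closed_openC.
- rewrite -subset0 => _ [[y [dy fy] <-] [z [dz nfz] dzy]]; apply: nfz.
  rewrite -(is_chart_invK hd dz) dzy is_chart_invK//; exact: interior_subset.
- by have [y [fy [dy ry]]] := clq _ qr; exists (d y); split=> //; exists y.
- apply: contrapT => nB; apply: nq; apply: filterS qr => y [dy ry].
  by apply: contrapT => nfy; apply: nB; exists (d y); split=> //; exists y.
- move=> z rz; have [y dy <-] := rd _ rz.
  have [fy|nfy] := pselect (range f y); last by left; right; exists y.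
  have [ify|nify] := pselect ((range f)° y); first by left; left; exists y.
  right; exists y => //; split=> //; case: fy nify => p _ <- nfp.
  by exists p => // p_regular; apply: nfp; exact: regular_value_interior.
Qed.
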